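(* Fix an integer $q\geq2$ and let $\mathbb{X}=\{X_k,k\in\mathbb{N}\}$ be a sequence of centered independent non-deterministic real random variables (in particular each $X_k$ is integrable). Let $(F_n,n\ge1)$ be random variables given by $F_n=\mathbb{E}[F_n]+\sum_{p=1}^q Q_p(f_{p,n};\mathbb{X})$ with $f_{p,n}\in\ell^2_0(\mathbb{N})^{\odot p}$ for each $p\in\{1,\dots,q\}$. Assume $d>q$ is an integer such that the support of $f_{p,n}$ is contained in $\{1,\dots,d\}^p$ for all $p\in\{1,\dots,q\}$ and $n\ge1$. Suppose $F_n$ converges almost surely to $F$, where $F=\mathbb{E}[F]+\sum_{p=1}^q Q_p(f_p;\mathbb{X})$ with $f_p\in\ell^2_0(\mathbb{N})^{\odot p}$ for each $p\in\{1,\dots,q\}$. Then, as $n\to\infty$, $\mathbb{E}[F_n]\to\mathbb{E}[F]$, and for every $p\in\{1,\dots,q\}$, $Q_p(f_{p,n};\mathbb{X})$ converges almost surely to $Q_p(f_p;\mathbb{X})$.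
   Context: $\mathbb{N}=\{1,2,\dots\}$. For $p\geq1$, $\ell^2_0(\mathbb{N})^{\odot p}$ is the set of square-summable functions $f$ on $\mathbb{N}^p$ that are symmetric in their arguments and vanish on diagonals ($f(i_1,\dots,i_p)=0$ whenever $i_j=i_k$ for some $j\ne k$). For such $f$, $Q_p(f;\mathbb{X})=\sum_{i_1,\dots,i_p\in\mathbb{N}} f(i_1,\dots,i_p)X_{i_1}\cdots X_{i_p}$, whenever this sum is well defined (e.g. when $f$ has finite support). *)

(* Defs.v *)
From HB Require Import structures.
From mathcomp Require Import all_boot all_order all_algebra all_fingroup.
From mathcomp Require Import all_classical all_reals all_analysis.
Set Implicit Arguments. Unset Strict Implicit. Unset Printing Implicit Defensive.
Import Order.TTheory GRing.Theory Num.Theory.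
Import numFieldNormedType.Exports.
Local Open Scope classical_set_scope.
Local Open Scope ring_scope.

(* Indexing convention: the paper's index set N = {1,2,...} is represented
   by Rocq's nat = {0,1,...} via the shift k <-> k+1.  Thus [X k] stands for
   X_{k+1}, a tuple t of nats stands for the index (t_1+1,...,t_p+1), and
   "support in {1,...,d}^p" becomes "all indices < d". *)

Section Defs.
Context {dsp : measure_display} {T : measurableType dsp} {R : realType}.

Definition mutually_independent (P : probability T R) (X : nat -> T -> R) :=
  forall (I : seq nat) (B : nat -> set R),
    uniq I -> (forall i, measurable (B i)) ->
    P (\bigcap_(i in [set` I]) (X i @^-1` B i)) =
    (\prod_(i <- I) P (X i @^-1` B i))%E.

Definition nondeterministic (P : probability T R) (Y : T -> R) :=
  ~ (exists c : R, {ae P, forall x, Y x = c}).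

Definition symmetric_fun (p : nat) (f : p.-tuple nat -> R) :=
  forall (s : 'S_p) (t : p.-tuple nat), f [tuple tnth t (s j) | j < p] = f t.

Definition vanishes_on_diagonals (p : nat) (f : p.-tuple nat -> R) :=
  forall t : p.-tuple nat, ~~ uniq t -> f t = 0.

Definition square_summable (p : nat) (f : p.-tuple nat -> R) :=
  exists M : R, forall N : nat,
    \sum_(t : p.-tuple 'I_N) (f (map_tuple (@nat_of_ord N) t)) ^+ 2 <= M.

Definition ell2_0 (p : nat) (f : p.-tuple nat -> R) :=
  [/\ symmetric_fun f, vanishes_on_diagonals f & square_summable f].

Definition supported_in (d p : nat) (f : p.-tuple nat -> R) :=
  forall t : p.-tuple nat, f t != 0 -> all (fun i => (i < d)%N) t.

Definition Qtrunc (X : nat -> T -> R) (N p : nat) (f : p.-tuple nat -> R)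
  (x : T) : R :=
  \sum_(t : p.-tuple 'I_N)
     f (map_tuple (@nat_of_ord N) t) * \prod_(j <- t) X j x.

(* Q_p(f; X) : the limit of the truncated sums (equal to the finite sum
   when f has finite support; "well defined" means the limit exists) *)
Definition Q (X : nat -> T -> R) (p : nat) (f : p.-tuple nat -> R) (x : T) : R :=
  lim ((fun N => Qtrunc X N f x) @ \oo).

Definition Q_well_defined (X : nat -> T -> R) (p : nat)
  (f : p.-tuple nat -> R) (x : T) : Prop :=
  cvg ((fun N => Qtrunc X N f x) @ \oo).

End Defs.

(* Main.v *)
(* With N_n = n + d, the difference of F_n and the truncation at N_n
   of the expansion of F is a multilinear polynomial H_n in X_0, ..., X_{N_n - 1}
   of degree at most q that tends to 0 almost surely, hence in probability. If
   A_n + X_k B_n -> 0 in probability and X_k is independent of (A_n, B_n), then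
   A_n -> 0 and B_n -> 0 in probability, because X_k, being centered and not
   constant, takes values of both signs with positive probability. Eliminating
   X_0, ..., X_{m-1} one at a time shows that for every set S of indices below m
   the coefficient of the monomial indexed by S, a polynomial in the remaining
   variables, tends to 0. A downward induction on #|S| then gives convergence
   of all numerical coefficients: once the coefficients of degree above #|S| are
   settled, those involving an index at least d do not depend on n, so they
   vanish, and for m >= d the coefficient of S is a constant. In particular the
   limit kernels f_p are supported in {0, ..., d-1}^p. *)
Require Import Defs.
From HB Require Import structures.
From mathcomp Require Import all_boot all_order all_algebra all_fingroup.
From mathcomp Require Import all_classical all_reals all_analysis.
From mathcomp Require Import measurable_realfun zify.
Set Implicit Arguments. Unset Strict Implicit. Unset Printing Implicit Defensive.
Import Order.TTheory GRing.Theory Num.Theory.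
Import numFieldNormedType.Exports.
Local Open Scope classical_set_scope.
Local Open Scope ring_scope.

(** * Independence of one coordinate from all the others *)

Section Independence.
Context (dsp : measure_display) (T : measurableType dsp) (R : realType).
Context (P : probability T R) (X : nat -> T -> R).
Hypothesis mX : forall k, measurable_fun setT (X k).
Hypothesis indX : mutually_independent P X.

(* The index [k] is left out of the intersection, so that these cylinders are a
   pi-system generating the sigma-algebra of the [X i] with [i != k]. *)
Definition cylinders_off (k : nat) : set (set T) :=
  [set E | exists B : nat -> set R, [/\ forall i, measurable (B i),
     exists n, forall i, (n <= i)%N -> B i = setT &
     E = \bigcap_(i in [set i | i != k]) (X i @^-1` B i)]].

Lemma measurable_preim k (B : set R) : measurable B -> measurable (X k @^-1` B).
Proof. by move=> mB; rewrite -[_ @^-1` _]setTI; exact: mX. Qed.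

Lemma cylinders_off_measurable k : cylinders_off k `<=` measurable.
Proof.
move=> _ [B [mB _ ->]].
apply: bigcap_measurable => [|i _]; last exact: measurable_preim.
by exists k.+1; rewrite /= gtn_eqF.
Qed.

Lemma cylinders_off_setI k : setI_closed (cylinders_off k).
Proof.
move=> _ _ [B [mB [n Bn] ->]] [C [mC [m Cm] ->]].
exists (fun i => B i `&` C i); split.
- by move=> i; exact: measurableI.
- exists (maxn n m) => i; rewrite geq_max => /andP[ni mi].
  by rewrite Bn// Cm// setTI.
- by rewrite -bigcapI; apply: eq_bigcapr => i _; rewrite preimage_setI.
Qed.

(** All but finitely many [B i] are [setT], so the cylinder is a finite intersection and mutual
    independence applies to [I] and to [k :: I]. *)
Lemma cylinder_independent k (D : set R) E : measurable D ->
  cylinders_off k E -> P (E `&` X k @^-1` D) = (P (X k @^-1` D) * P E)%E.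
Proof.
move=> mD [B [mB [n Bn] ->]].
pose I := [seq i <- iota 0 n | i != k].
have kI : k \notin I by rewrite mem_filter eqxx.
pose C i := if i == k then D else B i.
have mC i : measurable (C i) by rewrite /C; case: ifP.
have uI : uniq I by rewrite filter_uniq// iota_uniq.
have EI : \bigcap_(i in [set i | i != k]) (X i @^-1` B i) =
    \bigcap_(i in [set` I]) (X i @^-1` B i).
  apply/seteqP; split => x Bx i /=.
    by rewrite mem_filter => /andP[ik _]; exact: Bx.
  move=> ik; have [ni|ni] := leqP n i; first by rewrite Bn.
  by apply: Bx; rewrite /= mem_filter ik mem_iota.
have CI : \bigcap_(i in [set` I]) (X i @^-1` B i) =
    \bigcap_(i in [set` I]) (X i @^-1` C i).
  apply: eq_bigcapr => i /=; rewrite mem_filter => /andP[/negbTE ik _].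
  by rewrite /C ik.
rewrite EI (indX uI mB).
have -> : \bigcap_(i in [set` I]) (X i @^-1` B i) `&` X k @^-1` D =
    \bigcap_(i in [set` k :: I]) (X i @^-1` C i).
  have Ck : C k = D by rewrite /C eqxx.
  rewrite CI; apply/seteqP; split => x /=.
    by move=> [Cx Dx] i /=; rewrite inE => /predU1P[->|/Cx//]; rewrite Ck.
  move=> Cx; split=> [i iI|]; first by apply: Cx; rewrite /= inE iI orbT.
  by rewrite -Ck; apply: Cx; rewrite /= mem_head.
rewrite (@indX (k :: I) C)/= ?kI// big_cons {1}/C eqxx; congr (_ * _)%E.
rewrite big_seq [RHS]big_seq; apply: eq_bigr => i.
by rewrite mem_filter => /andP[/negbTE ik _]; rewrite /C ik.
Qed.

(** Both sides are finite measures of [E], one a restriction and the other a multiple of [P]. They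
    agree on a generating pi-system, hence on the sigma-algebra. *)
Lemma sigma_cylinders_independent k (D : set R) E : measurable D ->
  <<s cylinders_off k >> E ->
  P (E `&` X k @^-1` D) = (P (X k @^-1` D) * P E)%E.
Proof.
move=> mD sE; have mXD := measurable_preim k mD.
have P0 : (0 <= fine (P (X k @^-1` D)))%R by rewrite fine_ge0.
have PE : P (X k @^-1` D) = (NngNum P0)%:num%:E.
  by rewrite /= fineK// fin_num_measure.
rewrite PE.
apply: (g_sigma_algebra_measure_unique (cylinders_off k) _ (fun=> setT) _ _
  (mrestr P mXD) (mscale (NngNum P0) P) _ _ _ E sE).
- exact: cylinders_off_measurable.
- move=> _; exists (fun=> setT); split => //; first by exists 0%N.
  by apply/seteqP; split => // x _ i _.
- by apply/seteqP; split => // x _; exists 0%N.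
- exact: cylinders_off_setI.
- move=> A cA; rewrite /= /mrestr /mscale/=.
  by rewrite cylinder_independent// -PE.
- by move=> _; rewrite /= /mrestr setTI ltey_eq fin_num_measure.
Qed.

Lemma sigma_cylinders_coordinate k i (B : set R) : i != k -> measurable B ->
  cylinders_off k (X i @^-1` B).
Proof.
move=> ik mB; exists (fun j => if j == i then B else setT); split.
- by move=> j; case: ifP.
- by exists i.+1 => j ij; rewrite gtn_eqF.
- apply/seteqP; split => x /=; first by move=> Bx j _; case: eqP => // ->.
  by move=> /(_ i ik); rewrite eqxx.
Qed.

Lemma sub_sigma_cylinders k E : <<s cylinders_off k >> E -> measurable E.
Proof.
by apply: (smallest_sub (@sigma_algebra_measurable _ T));
  exact: cylinders_off_measurable.
Qed.

End Independence.

(** * Convergence in probability to zero *)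

Section ConvergenceInProbability.
Context (dsp : measure_display) (T : measurableType dsp) (R : realType).
Context (P : probability T R).

Definition vanishing (U : nat -> set T) :=
  forall r : R, 0 < r -> \forall n \near \oo, (P (U n) <= r%:E)%E.

Definition cvg0_in_prob (H : nat -> T -> R) :=
  forall e : R, 0 < e -> vanishing (fun n => [set x | e < `|H n x|]).

Lemma vanishing_subset (U V : nat -> set T) :
  (forall n, measurable (U n)) -> (forall n, measurable (V n)) ->
  (\forall n \near \oo, V n `<=` U n) -> vanishing U -> vanishing V.
Proof.
move=> mU mV VU U0 r r0; near=> n; apply: (@le_trans _ _ (P (U n))).
  by apply: le_measure; rewrite ?inE//; near: n.
by near: n; exact: U0.
Unshelve. all: end_near. Qed.

Lemma vanishingU (U V : nat -> set T) :
  (forall n, measurable (U n)) -> (forall n, measurable (V n)) ->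
  vanishing U -> vanishing V -> vanishing (fun n => U n `|` V n).
Proof.
move=> mU mV U0 V0 r r0; have r20 : 0 < r / 2 by rewrite divr_gt0.
near=> n; apply: (le_trans (measureU2 _ (mU n) (mV n))).
rewrite [in leRHS](splitr r) EFinD leeD//; near: n; [exact: U0|exact: V0].
Unshelve. all: end_near. Qed.

Lemma measurable_normr_gt (Y : T -> R) (e : R) :
  measurable_fun setT Y -> measurable [set x | e < `|Y x|].
Proof.
move=> mY; rewrite (_ : [set x | _] = setT `&` (Num.norm \o Y) @^-1` `]e, +oo[).
  by apply: measurableT_comp.
by rewrite setTI; apply/seteqP; split => x; rewrite /= in_itv/= andbT.
Qed.

(** By Egorov's theorem the convergence is uniform off a set [B] of measure below [r], so eventually
    [e < |H n|] only inside [B]. *)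
Lemma ae_cvg0_in_prob (H : nat -> T -> R) :
  (forall n, measurable_fun setT (H n)) ->
  {ae P, forall x, H n x @[n --> \oo] --> (0 : R)} -> cvg0_in_prob H.
Proof.
move=> mH H0 e e0 r r0.
have Poo : (P setT < +oo)%E by rewrite ltey_eq fin_num_measure.
have H0' : {ae P, forall x, setT x -> H n x @[n --> \oo] --> (0 : R)}.
  by apply: filterS H0 => x Hx _.
have [B [mB PB uB]] := ae_pointwise_almost_uniform mH (measurable_cst _)
  measurableT Poo H0' r0.
have eB : \forall n \near \oo, forall x, ~ B x -> `|H n x| < e.
  apply: (uB [set h : T -> R | forall x, ~ B x -> `|h x| < e]).
  apply/uniform_nbhs; exists [set xy | ball xy.1 e xy.2]; split.
    by rewrite -entourage_ballE; exists e.
  move=> h /= Hh x nBx; have := Hh x (conj I nBx).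
  by rewrite /ball/= sub0r normrN.
apply: filterS eB => n Hn; rewrite (le_trans _ (ltW PB))//.
apply: le_measure; rewrite ?inE//; first exact: measurable_normr_gt.
move=> x /= eH; apply: contrapT => /(Hn x); rewrite ltNge => /negP; apply.
exact: ltW.
Qed.

(** The event is empty or the whole space, so a probability at most 1/2 makes it empty. *)
Lemma cvg0_in_prob_cst (c : nat -> R) :
  cvg0_in_prob (fun n _ => c n) -> c @ \oo --> (0 : R).
Proof.
move=> c0; apply/cvgr0Pnorm_le => e e0.
have h0 : 0 < (2^-1 : R) by [].
have := c0 _ e0 _ h0; apply: filterS => n; apply: contraTT.
rewrite -ltNge => ec; rewrite (_ : [set _ | _] = setT); last by apply/seteqP; split.
by rewrite probability_setT lee_fin -ltNge invf_lt1// ltr1n.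
Qed.

(** If [Y <= 0] almost surely, then the mean of [|Y|] is minus that of [Y], that is 0, so [Y] is
    almost surely the constant 0. *)
Lemma centered_pos_proba (Y : T -> R) :
  P.-integrable setT (EFin \o Y) -> 'E_P[Y]%E = 0%E -> nondeterministic P Y ->
  P (Y @^-1` `]0, +oo[) != 0%E.
Proof.
move=> iY EY; apply: contra_notN => /eqP PY; exists 0.
have mY := measurable_int P iY.
have mY' : measurable_fun setT Y by exact/measurable_EFinP.
have Yle0 : {ae P, forall x, Y x <= 0}.
  exists (Y @^-1` `]0, +oo[); split => //.
    by rewrite -[_ @^-1` _]setTI; exact: mY'.
  by move=> x /= /negP; rewrite -ltNge in_itv/= andbT.
have : (\int[P]_x `|(Y x)%:E|)%E = 0%E.
  rewrite (ae_eq_integral (fun x => - (Y x)%:E)%E)//.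
  - rewrite integralN; last first.
      by rewrite fin_num_adde_defr// integrable_pos_fin_num.
    by move: EY; rewrite unlock => ->; rewrite oppe0.
  - exact: measurableT_comp.
  - exact: measurableT_comp.
  - by apply: filterS Yle0 => x Yx _ /=; rewrite ler0_norm.
move=> /(ae_eq_integral_abs _ measurableT mY); apply: filterS => x /=.
by move=> /(_ I)[].
Qed.

Lemma preimage_bigcup_proba (Y : T -> R) (D : nat -> set R) :
  measurable_fun setT Y -> (forall i, measurable (D i)) ->
  P (Y @^-1` \bigcup_i D i) != 0%E -> exists i, (0 < P (Y @^-1` D i))%E.
Proof.
move=> mY mD; apply: contra_neqP => /forallNP D0.
have mYD i : measurable (Y @^-1` D i).
  by rewrite -[_ @^-1` _]setTI; exact: mY.
rewrite preimage_bigcup; apply/negligibleP; first exact: bigcupT_measurable.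
apply: negligible_bigcup => i; apply/negligibleP => //.
by apply/eqP; rewrite -measure_le0 leNgt; exact/negP/D0.
Qed.

(** The half-line []0, +oo[] is the countable union of the half-lines [[1/(i+1), +oo[], so one of
    these has positive probability. *)
Lemma centered_ge_proba (Y : T -> R) :
  P.-integrable setT (EFin \o Y) -> 'E_P[Y]%E = 0%E -> nondeterministic P Y ->
  exists2 a, 0 < a & (0 < P (Y @^-1` `[a, +oo[))%E.
Proof.
move=> iY EY nY.
have mY : measurable_fun setT Y by apply/measurable_EFinP; exact: measurable_int iY.
have := centered_pos_proba iY EY nY.
rewrite (_ : [set` `]0, +oo[] = \bigcup_i [set` `[i.+1%:R^-1 : R, +oo[]); last first.
  apply/seteqP; split => x /=; rewrite in_itv/= andbT.
    move=> x0; have [N _ /(_ N (leqnn _))] := near_infty_natSinv_lt (PosNum x0).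
    by move=> Nx; exists N => //=; rewrite in_itv/= andbT ltW.
  by move=> [i _]; rewrite /= in_itv/= andbT; apply: lt_le_trans.
move=> /preimage_bigcup_proba => /(_ mY)[//|i Pi].
by exists i.+1%:R^-1.
Qed.

End ConvergenceInProbability.

(** * Separating the coefficients of an affine expression in one coordinate *)

Section IndependentStep.
Context (dsp : measure_display) (T : measurableType dsp) (R : realType).
Context (P : probability T R) (X : nat -> T -> R).
Hypothesis mX : forall k, measurable_fun setT (X k).
Hypothesis indX : mutually_independent P X.

(** Independence from [X k] is expressed as measurability for the sigma-algebra of the other
    coordinates, a second measurable structure on [T]. *)
Definition measurable_off (k : nat) (Y : T -> R) :=
  measurable_fun (setT : set (g_sigma_algebraType (cylinders_off X k))) Y.

Lemma measurable_off_preim k Y (D : set R) : measurable_off k Y ->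
  measurable D -> <<s cylinders_off X k >> (Y @^-1` D).
Proof. by move=> mY mD; rewrite -[_ @^-1` _]setTI; exact: mY. Qed.

Lemma measurable_off_measurable k Y : measurable_off k Y ->
  measurable_fun setT Y.
Proof.
move=> mY _ D mD; rewrite setTI; apply: (@sub_sigma_cylinders _ _ _ X mX k).
exact: measurable_off_preim.
Qed.

Lemma measurable_off_coordinate k i : i != k -> measurable_off k (X i).
Proof.
move=> ik _ D mD; rewrite setTI; apply: sub_sigma_algebra.
exact: sigma_cylinders_coordinate.
Qed.

(** By independence, [P (E n)] times the positive probability that [X k] lies in [D], a number free
    of [n], is eventually at most [P (U n)]. *)
Lemma vanishing_off k (D : set R) (E U : nat -> set T) :
  measurable D -> (0 < P (X k @^-1` D))%E ->
  (forall n, <<s cylinders_off X k >> (E n)) -> (forall n, measurable (U n)) ->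
  (\forall n \near \oo, E n `&` X k @^-1` D `<=` U n) ->
  vanishing P U -> vanishing P E.
Proof.
move=> mD PD sE mU EDU U0 r r0.
have mXD := measurable_preim mX k mD.
have mE n : measurable (E n) by exact: sub_sigma_cylinders (sE n).
have PDfin : P (X k @^-1` D) \is a fin_num by exact: fin_num_measure.
have b0 : 0 < fine (P (X k @^-1` D)) by rewrite fine_gt0// PD ltey_eq PDfin.
have V0 : vanishing P (fun n => E n `&` X k @^-1` D).
  by apply: vanishing_subset EDU U0 => // n; exact: measurableI.
apply: filterS (V0 _ (mulr_gt0 b0 r0)) => n.
rewrite (sigma_cylinders_independent mX indX mD (sE n)).
by rewrite EFinM fineK// lee_pmul2l.
Qed.

(* On the event [e < |B|], the sign of [A * B] is independent of [X k], and when
   it agrees with the sign of [X k * B ^+ 2], no cancellation occurs in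
   [A + X k * B]. *)
Lemma affine_cvg0_in_prob k (A B H : nat -> T -> R) :
  P.-integrable setT (EFin \o X k) -> 'E_P[X k]%E = 0%E ->
  nondeterministic P (X k) ->
  (forall n, measurable_off k (A n)) -> (forall n, measurable_off k (B n)) ->
  (forall n, measurable_fun setT (H n)) ->
  (\forall n \near \oo, forall x, H n x = A n x + X k x * B n x) ->
  cvg0_in_prob P H -> cvg0_in_prob P A /\ cvg0_in_prob P B.
Proof.
move=> iX EX nX sA sB mH HAB H0.
have mA n := measurable_off_measurable (sA n).
have mB n := measurable_off_measurable (sB n).
have mU (Z : nat -> T -> R) (e : R) : (forall n, measurable_fun setT (Z n)) ->
    forall n, measurable [set x | e < `|Z n x|].
  by move=> mZ n; exact: measurable_normr_gt.
have off_norm (Z : nat -> T -> R) (e : R) : (forall n, measurable_off k (Z n)) ->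
    forall n, <<s cylinders_off X k >> [set x | e < `|Z n x|].
  move=> sZ n; exact: (@measurable_normr_gt _
    (g_sigma_algebraType (cylinders_off X k)) R (Z n) e (sZ n)).
have [a a0 Pa] := centered_ge_proba iX EX nX.
(* The lower tail of [X k] is the upper tail of [- X k], which is again centered and
   nondeterministic. *)
have [b b0 Pb] : exists2 b : R, 0 < b & (0 < P (X k @^-1` [set` `]-oo, (- b)%R]]))%E.
  have [|||b b0 Pb] := @centered_ge_proba _ _ _ P (fun x => - X k x).
  - exact: integrableN iX.
  - rewrite unlock (_ : (fun x => _) = (fun x => - (X k x)%:E)%E)// integralN.
      by move: EX; rewrite unlock => ->; rewrite oppe0.
    by rewrite fin_num_adde_defr// integrable_pos_fin_num.
  - move=> [c Xc]; apply: nX; exists (- c).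
    by apply: filterS Xc => x <-; rewrite opprK.
  exists b => //; rewrite (_ : _ @^-1` _ = (fun x => - X k x) @^-1` [set` `[b, +oo[])//.
  by apply/seteqP; split => x; rewrite /= !in_itv/= andbT lerNr.
have B0 : cvg0_in_prob P B.
  move=> e e0.
  have sAB (s : bool) n : <<s cylinders_off X k >> ([set x | e < `|B n x|] `&`
      (fun x => (-1) ^+ s * (A n x * B n x)) @^-1` `[0, +oo[).
    apply: (@measurableI _ (g_sigma_algebraType (cylinders_off X k))).
      exact: off_norm.
    apply: measurable_off_preim => //.
    apply: measurable_funM; first exact: measurable_cst.
    exact: (measurable_funM (sA n) (sB n)).
  (* [D] holds values of sign [(-1) ^+ s] and modulus at least [c]; when [X k] lies in [D], the
     event gives [|H| >= c * |B| > c * e]. *)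
  have V (s : bool) (D : set R) c : measurable D -> (0 < P (X k @^-1` D))%E ->
      0 < c -> (forall y, D y -> c <= (-1) ^+ s * y) ->
      vanishing P (fun n => [set x | e < `|B n x|] `&`
        (fun x => (-1) ^+ s * (A n x * B n x)) @^-1` `[0, +oo[).
    move=> mD PD c0 cD; have ce0 : 0 < c * e by exact: mulr_gt0.
    apply: (vanishing_off mD PD (sAB s) _ _ (H0 _ ce0)); first exact: mU.
    apply: filterS HAB => n HAB x /= [[eB]]; rewrite in_itv/= andbT => AB0 Dx.
    have B_gt0 : 0 < `|B n x| by exact: lt_trans eB.
    apply: (@lt_le_trans _ _ (c * `|B n x|)); first by rewrite ltr_pM2l.
    (* After multiplication by [|B|], the bound follows from [(-1) ^+ s * H * B >= (-1) ^+ s * X k *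
       B ^+ 2 >= c * B ^+ 2]. *)
    rewrite -(ler_pM2r B_gt0) -normrM -(normrMsign s).
    apply: le_trans (ler_norm _).
    have BB : 0 <= B n x * B n x by rewrite -expr2 sqr_ge0.
    rewrite -mulrA -normrM ger0_norm// HAB mulrDl mulrDr -[leLHS]add0r lerD//.
    by rewrite -[X k x * _ * _]mulrA [leRHS]mulrA ler_wpM2r// cD.
  have mE s n := sub_sigma_cylinders mX (sAB s n).
  have Va y : [set` `[a, +oo[] y -> a <= (-1) ^+ false * y.
    by rewrite /= in_itv/= andbT mul1r.
  have Vb y : [set` `]-oo, - b]] y -> b <= (-1) ^+ true * y.
    by rewrite /= in_itv/= mulN1r lerNr.
  have V0 := V false _ a (measurable_itv _) Pa a0 Va.
  have V1 := V true _ b (measurable_itv _) Pb b0 Vb.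
  apply: (vanishing_subset _ _ _ (vanishingU (mE false) (mE true) V0 V1)).
  - by move=> n; apply: measurableU; exact: mE.
  - exact: mU.
  - apply: nearW => n x /= eB; rewrite !in_itv/= !andbT mul1r mulN1r oppr_ge0.
    by have [AB|/ltW AB] := leP 0 (A n x * B n x); [left|right].
split=> // e e0.
(* For [A], restrict to [|X k| <= M], an event of positive probability: there [|A| > e] forces
   [|H| > e / 2] or [|B| > e / (2 * M)]. *)
have [M M0 PM] : exists2 M : R, 0 < M & (0 < P (X k @^-1` [set` `[(- M)%R, M]]))%E.
  have [| |i Pi] := @preimage_bigcup_proba _ _ _ P (X k)
      (fun i => [set` `[- i.+1%:R, i.+1%:R]]) (mX k).
  - by [].
  - rewrite (_ : _ @^-1` _ = setT) ?probability_setT ?oner_eq0//.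
    apply/seteqP; split => // x _; exists (Num.truncn `|X k x|) => //=.
    by rewrite in_itv/= -ler_norml ltW// truncnS_gt.
  by exists i.+1%:R.
have U0 : vanishing P (fun n => [set x | e / 2 < `|H n x|] `|`
                               [set x | e / (2 * M) < `|B n x|]).
  apply: vanishingU; try exact: mU.
    by apply: H0; rewrite divr_gt0.
  by apply: B0; rewrite divr_gt0// mulr_gt0.
apply: (vanishing_off _ PM _ _ _ U0) => //.
- exact: off_norm.
- by move=> n; apply: measurableU; exact: mU.
apply: filterS HAB => n HAB x [/= eA]; rewrite in_itv/= -ler_norml => XM.
apply: contrapT => /not_orP[/negP + /negP]; rewrite -!leNgt => Hle Ble.
move: eA; apply/negP; rewrite -leNgt.
rewrite (_ : A n x = H n x - X k x * B n x); last by rewrite HAB addrK.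
rewrite (le_trans (ler_normB _ _))// (splitr e) lerD// normrM.
rewrite (le_trans (ler_pM _ _ XM Ble))// invfM mulrCA.
by rewrite [2^-1 * _]mulrC mulVKf ?gt_eqF.
Qed.
End IndependentStep.

(** * Multilinear polynomials and their coefficients in the first variables *)

Section PartialPolynomials.
Context (dsp : measure_display) (T : measurableType dsp) (R : realType).
Context (X : nat -> T -> R) (q : nat).
Implicit Types (g : forall p, p.-tuple nat -> R) (C : pred (seq nat)).

Local Notation ntuple t := (map_tuple (@nat_of_ord _) t).

(* For [C := trace_eq m b], the coefficient of the monomial indexed by
   [{i < m | b i}] in [\sum_p Qtrunc X N (g p)], as a polynomial in the [X j] with
   [m <= j]. *)
Definition subpoly (N : nat) C (m : nat) g (x : T) : R :=
  \sum_(p < q.+1) \sum_(t : p.-tuple 'I_N | C (ntuple t))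
     g p (ntuple t) * \prod_(j <- ntuple t | (m <= j)%N) X j x.

Definition trace_eq (m : nat) (b : pred nat) : pred (seq nat) :=
  fun s => all (fun i => (i \in s) == b i) (iota 0 m).

Lemma trace_eqS m b s :
  trace_eq m.+1 b s = trace_eq m b s && ((m \in s) == b m).
Proof. by rewrite /trace_eq -addn1 iotaD all_cat /= andbT. Qed.

Lemma trace_eqP m b s :
  reflect (forall i, (i < m)%N -> (i \in s) = b i) (trace_eq m b s).
Proof.
apply: (iffP allP) => [h i im|h i]; first by apply/eqP/h; rewrite mem_iota.
by rewrite mem_iota => im; apply/eqP/h.
Qed.

Lemma subpoly0 N b g x :
  subpoly N (trace_eq 0 b) 0 g x = \sum_(p < q.+1) Qtrunc X N (g p) x.
Proof.
apply: eq_bigr => p _; apply: eq_bigr => t _; congr (_ * _).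
by rewrite big_map.
Qed.

Lemma prod_geq_split (F : nat -> R) (m : nat) (s : seq nat) : uniq s ->
  m \in s -> \prod_(j <- s | (m <= j)%N) F j = F m * \prod_(j <- s | (m < j)%N) F j.
Proof.
move=> us ms; rewrite (bigID (pred1 m)) /=; congr (_ * _); last first.
  by apply: eq_bigl => j; rewrite ltn_neqAle eq_sym andbC.
rewrite (eq_bigl (pred1 m)) => [|j]; last first.
  by rewrite /= andb_idl// => /eqP ->.
by rewrite -big_filter filter_pred1_uniq// big_seq1.
Qed.

Lemma prod_geq_notin (F : nat -> R) (m : nat) (s : seq nat) : m \notin s ->
  \prod_(j <- s | (m <= j)%N) F j = \prod_(j <- s | (m < j)%N) F j.
Proof.
move=> ms; rewrite big_seq_cond [RHS]big_seq_cond; apply: eq_bigl => j.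
by have [->|mj] := eqVneq j m;
  rewrite ?(negbTE ms)// [in RHS]ltn_neqAle eq_sym mj.
Qed.

(** Kernels vanish on diagonals, so [X m] has degree at most one in every surviving monomial:
    splitting by whether [m] occurs gives an affine expression in [X m]. *)
Lemma subpoly_split N C m g x :
  (forall p, (p <= q)%N -> vanishes_on_diagonals (g p)) ->
  subpoly N C m g x =
    subpoly N [pred s | C s && (m \notin s)] m.+1 g x +
    X m x * subpoly N [pred s | C s && (m \in s)] m.+1 g x.
Proof.
move=> g0; rewrite /subpoly mulr_sumr -big_split/=; apply: eq_bigr => p _.
rewrite (bigID (fun t : p.-tuple 'I_N => m \in val (ntuple t))) /= addrC.
congr (_ + _).
  by apply: eq_bigr => t /andP[_ mt]; rewrite prod_geq_notin.
rewrite mulr_sumr; apply: eq_bigr => t /andP[_ mt].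
have [ut|nut] := boolP (uniq (ntuple t)); last first.
  by rewrite g0 ?mul0r ?mulr0// -ltnS.
by rewrite prod_geq_split// mulrCA.
Qed.

(** The bit [b m] selects one of the two coefficients produced by [subpoly_split]. *)
Lemma subpolyS N m b g x :
  subpoly N (trace_eq m.+1 b) m.+1 g x =
  subpoly N [pred s | trace_eq m b s & if b m then m \in s else m \notin s]
    m.+1 g x.
Proof.
apply: eq_bigr => p _; apply: eq_bigl => t; rewrite trace_eqS /=.
by case: (b m); rewrite ?eqb_id ?eqbF_neg.
Qed.

(* [K] counts the orderings of [t]. *)
Lemma subpoly_trace_eq N p (t : p.-tuple nat) m g x : (p <= q)%N -> uniq t ->
  all (fun i => (i < m)%N) t -> (m <= N)%N ->
  (forall p, (p <= q)%N -> vanishes_on_diagonals (g p)) ->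
  symmetric_fun (g p) ->
  (forall p', (p < p' <= q)%N -> forall t' : p'.-tuple nat, uniq t' ->
    ~~ all (fun i => (i < m)%N) t' -> g p' t' = 0) ->
  exists2 K, (0 < K)%N & subpoly N (trace_eq m (mem t)) m g x = g p t *+ K.
Proof.
move=> pq ut tm mN gdiag gsym g0.
have tP p' (t' : p'.-tuple 'I_N) : trace_eq m (mem t) (ntuple t') ->
    {subset t <= ntuple t'}.
  move=> /trace_eqP tt' i it; rewrite tt' ?inE//.
  exact: (allP tm).
exists #|[pred t' : p.-tuple 'I_N | trace_eq m (mem t) (ntuple t')]|.
  (* [t] itself, its entries read as ordinals below [N], is one of the tuples counted. *)
  apply/card_gt0P.
  have tN : all (fun i => (i < N)%N) t.
    by apply/allP => i /(allP tm) im; exact: leq_trans mN.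
  pose s : seq 'I_N := pmap insub t.
  have ss : map val s = t.
    rewrite /s pmap_filter; last exact: insubK.
    by apply/all_filterP; apply: sub_all tN => i iN; rewrite insubT.
  have sp : size s == p by rewrite -(size_map val) ss size_tuple.
  by exists (Tuple sp); rewrite inE /=; apply/trace_eqP => i _; rewrite ss.
(* In degree [p], a tuple containing [t] is a permutation of it, and no index is left in the
   product. *)
rewrite /subpoly (bigD1 (Ordinal (pq : (p < q.+1)%N)))//= [X in _ + X]big1.
  rewrite addr0 -sumr_const; apply: eq_bigr => t' tt'.
  have tt'P := tP _ _ tt'.
  have st : (size (ntuple t') <= size t)%N by rewrite !size_tuple.
  have [_ tE] := uniq_min_size ut tt'P st.
  have ut' := leq_size_uniq ut tt'P st.
  rewrite big_seq_cond big_pred0 ?mulr1; last first.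
    move=> i; apply/negP => /andP[]; rewrite -tE => /(allP tm).
    by rewrite ltnNge => /negbTE ->.
  have /tuple_permP[s t's] : perm_eq (ntuple t') t.
    by apply: uniq_perm => // i; rewrite -tE.
  by rewrite -(gsym s t); congr (g p _); exact: val_inj.
(* In another degree, containing [t] without repetition forces [p < p']; then some entry is at least
   [m], since entries below [m] belong to [t], and [g0] applies. *)
move=> p' p'p; apply: big1 => t' tt'; have tt'P := tP _ _ tt'.
have [ut'|nut'] := boolP (uniq (ntuple t')); last first.
  by rewrite gdiag ?mul0r// -ltnS.
have pp' : (p < p')%N.
  rewrite ltn_neqAle; apply/andP; split.
    by apply: contra p'p => /eqP pp'; apply/eqP/val_inj.
  by have := uniq_leq_size ut tt'P; rewrite !size_tuple.
rewrite g0 ?mul0r//; first by rewrite pp' /= -ltnS.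
apply/negP => /allP t'm; move: pp'; apply/negP; rewrite -leqNgt.
suff : (size (ntuple t') <= size t)%N by rewrite !size_tuple.
apply: uniq_leq_size => // i it'.
by move/trace_eqP: tt' => /(_ i (t'm i it')); rewrite it' inE => <-.
Qed.

(** Measurability is asked of the [X i] with [m <= i], so that the lemma also applies over the
    sigma-algebra of the coordinates other than some [k < m]. *)
Lemma measurable_subpoly N C m g :
  (forall i, (m <= i)%N -> measurable_fun setT (X i)) ->
  measurable_fun setT (subpoly N C m g).
Proof.
move=> mX; apply: measurable_sum => p.
rewrite (_ : (fun x => _) = fun x => \sum_(t <- enum (fun t : p.-tuple 'I_N =>
    C (ntuple t))) g p (ntuple t) *
    \prod_(j <- [seq j <- ntuple t | (m <= j)%N]) X j x); last first.
  by apply/funext => x; rewrite big_enum; apply: eq_bigr => t _; rewrite big_filter.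
apply: measurable_sum => t; apply: measurable_funM; first exact: measurable_cst.
by apply: measurable_prod => i; rewrite mem_filter => /andP[+ _]; exact: mX.
Qed.

End PartialPolynomials.

(** * Elimination of the variables one at a time *)

Section SubpolyConvergence.
Context (dsp : measure_display) (T : measurableType dsp) (R : realType).
Context (X : nat -> T -> R) (q : nat).
Context (P : probability T R).
Hypothesis mX : forall k, measurable_fun setT (X k).
Hypothesis indX : mutually_independent P X.
Hypothesis iX : forall k, P.-integrable setT (EFin \o X k).
Hypothesis EX : forall k, 'E_P[X k]%E = 0%E.
Hypothesis nX : forall k, nondeterministic P (X k).

Lemma measurable_off_subpoly N C m k (g : forall p, p.-tuple nat -> R) :
  (k < m)%N -> measurable_off X k (subpoly X q N C m g).
Proof.
move=> km.
apply: (@measurable_subpoly _ (g_sigma_algebraType (cylinders_off X k)) R X q).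
move=> i mi; apply: measurable_off_coordinate.
by rewrite gtn_eqF// (leq_trans km).
Qed.

(** Induction on [m]: by [subpoly_split] and [affine_cvg0_in_prob] both coefficients in [X m] tend
    to 0, and [b m] picks the one required. *)
Lemma subpoly_cvg0_in_prob (N : nat -> nat)
    (g : nat -> forall p, p.-tuple nat -> R) b m :
  (forall n p, (p <= q)%N -> vanishes_on_diagonals (g n p)) ->
  cvg0_in_prob P (fun n x => \sum_(p < q.+1) Qtrunc X (N n) (g n p) x) ->
  cvg0_in_prob P (fun n => subpoly X q (N n) (trace_eq m b) m (g n)).
Proof.
move=> gdiag H0; elim: m => [|m IH].
  rewrite (_ : (fun n => _) =
    (fun n x => \sum_(p < q.+1) Qtrunc X (N n) (g n p) x))//.
  by apply/funext => n; apply/funext => x; rewrite subpoly0.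
rewrite (_ : (fun n => _) = fun n => subpoly X q (N n)
    [pred s | trace_eq m b s & if b m then m \in s else m \notin s] m.+1 (g n));
  last by apply/funext => n; apply/funext => x; rewrite subpolyS.
have [|||||IHA IHB] := @affine_cvg0_in_prob _ _ _ P X mX indX m
  (fun n => subpoly X q (N n) [pred s | trace_eq m b s && (m \notin s)] m.+1 (g n))
  (fun n => subpoly X q (N n) [pred s | trace_eq m b s && (m \in s)] m.+1 (g n))
  (fun n => subpoly X q (N n) (trace_eq m b) m (g n)) (iX m) (EX m) (@nX m).
- by move=> n; exact: measurable_off_subpoly.
- by move=> n; exact: measurable_off_subpoly.
- by move=> n; exact: measurable_subpoly.
- by apply: nearW => n x; apply: subpoly_split => p; exact: gdiag.
- exact: IH.
by case: (b m).
Qed.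

End SubpolyConvergence.

(** * Homogeneous sums of finitely supported kernels *)

Section FiniteSupport.
Context (dsp : measure_display) (T : measurableType dsp) (R : realType).
Context (X : nat -> T -> R).

Lemma Qtrunc_supported d N p (f : p.-tuple nat -> R) x :
  (0 < d)%N -> (d <= N)%N -> supported_in d f ->
  Qtrunc X N f x = Qtrunc X d f x.
Proof.
case: d => // d _ dN fd; rewrite /Qtrunc.
pose h : p.-tuple 'I_d.+1 -> p.-tuple 'I_N := map_tuple (widen_ord dN).
(* [h'] inverts [h] on tuples with entries below [d.+1]; elsewhere [inord] yields a default
   value. *)
pose h' : p.-tuple 'I_N -> p.-tuple 'I_d.+1 := map_tuple (fun i : 'I_N => inord i).
rewrite (bigID (fun t : p.-tuple 'I_N => all (fun i : 'I_N => (i < d.+1)%N) t)).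
rewrite /= [X in _ + X]big1 ?addr0; last first.
  move=> t td; case: (eqVneq (f (map_tuple (@nat_of_ord N) t)) 0) => [->|].
    by rewrite mul0r.
  by move=> /fd; rewrite /= all_map => /(elimN idP).
rewrite (reindex_onto h h') /=; last first.
  move=> t /allP td; apply/val_inj => /=; rewrite -map_comp map_id_in// => i it.
  by apply/val_inj; rewrite /= inordK// td.
apply: eq_big => [t|t _].
  rewrite all_map; apply/andP; split; first by apply/allP => i _ /=.
  apply/eqP/val_inj => /=; rewrite -map_comp map_id_in// => i _.
  by apply/val_inj; rewrite /= inordK.
rewrite /= big_map; congr (f _ * _).
by apply/val_inj; rewrite /= -map_comp.
Qed.

(** The truncated sums are constant from [N = d] on, so the limit is reached at every [x]. *)
Lemma Q_supported d p (f : p.-tuple nat -> R) x :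
  (0 < d)%N -> supported_in d f -> Q X f x = Qtrunc X d f x.
Proof.
move=> d0 fd; apply: cvg_lim => //.
apply: cvg_near_cst; exists d => // N /= dN.
by rewrite (Qtrunc_supported x d0 dN fd).
Qed.

Lemma Qtrunc0 N (f : 0.-tuple nat -> R) x : Qtrunc X N f x = f [tuple].
Proof.
rewrite /Qtrunc (big_pred1 [tuple]) => [|t]; last exact/esym/eqP/tuple0.
by rewrite big_nil mulr1; congr f; exact: val_inj.
Qed.

Lemma measurable_Qtrunc N p (f : p.-tuple nat -> R) :
  (forall k, measurable_fun setT (X k)) -> measurable_fun setT (Qtrunc X N f).
Proof.
move=> mX; apply: measurable_sum => t.
by apply: measurable_funM; [exact: measurable_cst|exact: measurable_prod].
Qed.

End FiniteSupport.

(** * From almost sure convergence to convergence of the kernels *)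

Theorem theorem1p4 (dsp : measure_display) (T : measurableType dsp)
  (R : realType) (P : probability T R) (q d : nat) (X : nat -> T -> R)
  (Fn : nat -> T -> R) (fn : nat -> forall p : nat, p.-tuple nat -> R)
  (F : T -> R) (f : forall p : nat, p.-tuple nat -> R) :
  (2 <= q)%N ->
  (forall k, measurable_fun setT (X k)) ->
  (forall k, P.-integrable setT (EFin \o X k)) ->
  (forall k, 'E_P[X k]%E = 0%E) ->
  mutually_independent P X ->
  (forall k, nondeterministic P (X k)) ->
  (forall n p, (1 <= p <= q)%N -> ell2_0 (fn n p)) ->
  (q < d)%N ->
  (forall n p, (1 <= p <= q)%N -> supported_in d (fn n p)) ->
  (forall n, P.-integrable setT (EFin \o Fn n)) ->
  (forall n, {ae P, forall x,
     Fn n x = fine 'E_P[Fn n]%E + \sum_(1 <= p < q.+1) Q X (fn n p) x}) ->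
  (forall p, (1 <= p <= q)%N -> ell2_0 (f p)) ->
  (forall p, (1 <= p <= q)%N -> {ae P, forall x, Q_well_defined X (f p) x}) ->
  P.-integrable setT (EFin \o F) ->
  {ae P, forall x,
     F x = fine 'E_P[F]%E + \sum_(1 <= p < q.+1) Q X (f p) x} ->
  {ae P, forall x, Fn n x @[n --> \oo] --> F x} ->
  ('E_P[Fn n]%E @[n --> \oo] --> 'E_P[F]%E) /\
  (forall p, (1 <= p <= q)%N ->
     {ae P, forall x, Q X (fn n p) x @[n --> \oo] --> Q X (f p) x}).
Proof.
move=> q2 mX iX EX indX nX fn_ell qd fn_supp iFn Fn_eq f_ell f_wd iF F_eq FnF.
have d0 : (0 < d)%N by exact: leq_ltn_trans qd.
pose cn n := fine 'E_P[Fn n]%E - fine 'E_P[F]%E.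
(* The difference of the means becomes the kernel of degree 0, so that [g0] below covers both
   conclusions. *)
pose g n p (t : p.-tuple nat) : R :=
  if p == 0%N then cn n else fn n p t - f p t.
have gdiag n p : (p <= q)%N -> vanishes_on_diagonals (g n p).
  case: p => [_ t|p pq t nt]; first by rewrite tuple0.
  have [_ fn0 _] := fn_ell n p.+1 pq; have [_ f0 _] := f_ell p.+1 pq.
  by rewrite /g /= fn0// f0// subr0.
have gsym n p : (p <= q)%N -> symmetric_fun (g n p).
  case: p => [_ s t|p pq s t]; first by rewrite /g.
  have [fns _ _] := fn_ell n p.+1 pq; have [fs _ _] := f_ell p.+1 pq.
  by rewrite /g /= fns fs.
(* The level [n + d] is at least [d], so the sums for [fn] are exact, and tends to infinity, so
   those for [f] converge almost surely. *)
pose H n x := \sum_(p < q.+1) Qtrunc X (n + d) (g n p) x.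
have mH n : measurable_fun setT (H n).
  by apply: measurable_sum => p; exact: measurable_Qtrunc.
have HE n x : Fn n x = fine 'E_P[Fn n]%E + \sum_(1 <= p < q.+1) Q X (fn n p) x ->
    H n x = Fn n x -
    (fine 'E_P[F]%E + \sum_(1 <= p < q.+1) Qtrunc X (n + d) (f p) x).
  move=> ->; rewrite /H -(big_mkord predT (fun p => Qtrunc X (n + d) (g n p) x)).
  rewrite big_ltn// Qtrunc0 opprD addrACA -sumrB; congr (_ + _).
  rewrite !big_add1 /=; apply: eq_big_nat => p /andP[_ pq].
  rewrite (Q_supported _ _ d0 (fn_supp n p.+1 pq)).
  rewrite -(Qtrunc_supported _ _ d0 (leq_addl n d) (fn_supp n p.+1 pq)).
  by rewrite /Qtrunc -sumrB; apply: eq_bigr => t _; rewrite -mulrBl.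
have H0 : {ae P, forall x, H n x @[n --> \oo] --> (0 : R)}.
  have f_wd' : {ae P, forall x p, (1 <= p <= q)%N -> Q_well_defined X (f p) x}.
    apply/ae_foralln => p; have [pq|_] := boolP (1 <= p <= q)%N.
      by apply: filterS (f_wd p pq) => x.
    by apply: aeW.
  have Fn_eq' := ae_foralln Fn_eq.
  apply: filterS3 FnF F_eq (filterI f_wd' Fn_eq') => x FnFx Fx [wdx Fnx].
  rewrite (_ : (fun n => _) = fun n => Fn n x -
    (fine 'E_P[F]%E + \sum_(1 <= p < q.+1) Qtrunc X (n + d) (f p) x)); last first.
    by apply/funext => n; exact: HE.
  have FN : (fun n => fine 'E_P[F]%E +
      \sum_(1 <= p < q.+1) Qtrunc X (n + d) (f p) x) @ \oo --> F x.
    rewrite Fx; apply: cvgD; first exact: cvg_cst.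
    rewrite big_add1 big_mkord (_ : (fun n => _) =
      fun n => \sum_(p < q) Qtrunc X (n + d) (f p.+1) x); last first.
      by apply/funext => n; rewrite big_add1 big_mkord.
    apply: cvg_big => [|p _]; first exact: add_continuous.
    have := wdx p.+1 (ltn_ord p); rewrite /Q_well_defined.
    by rewrite -(cvg_shiftn d).
  by have := cvgB FnFx FN; rewrite subrr; exact.
have HP : cvg0_in_prob P H by exact: ae_cvg0_in_prob.
(* If an entry of [t] is at least [d], then [fn n p t = 0] and [g n p t] is the constant [- f p t],
   which must equal its limit 0. *)
have f_zero p : (0 < p <= q)%N -> (forall t : p.-tuple nat, uniq t ->
    (fun n => g n p t) @ \oo --> (0 : R)) -> supported_in d (f p).
  move=> /andP[p0 pq] gp0 t; apply: contra_neqT => td.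
  have p0q : (0 < p <= q)%N by rewrite p0.
  have [ut|nut] := boolP (uniq t); last first.
    by have [_ + _] := f_ell p p0q; exact.
  have fnt n : fn n p t = 0.
    by apply/eqP; apply: contraNT td; exact: fn_supp.
  have := gp0 t ut; rewrite (_ : (fun n => _) = cst (- f p t)).
    move=> c0; apply/eqP; rewrite -oppr_eq0; apply/eqP.
    apply: (norm_cvg_unique _ c0); exact: cvg_cst.
  by apply/funext => n; rewrite /g gtn_eqF// fnt sub0r.
have g0 p : (p <= q)%N -> forall t : p.-tuple nat, uniq t ->
    (fun n => g n p t) @ \oo --> (0 : R).
  (* Downward induction on [p], run on [q - p < k], so that the kernels of [f] of higher degree are
     already known to be supported below [d]. *)
  have [k] := ubnP (q - p); elim: k p => // k IH p qpk pq t ut.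
  have IHp p' : (p < p' <= q)%N -> supported_in d (f p').
    move=> /andP[pp' p'q]; apply: f_zero; first by rewrite p'q (leq_ltn_trans _ pp').
    by apply: IH => //; lia.
  (* Exceeding every entry of [t], [m] turns the coefficient of [t] into a constant; being at least
     [d], it makes higher kernels vanish on tuples with an entry at or above [m]. *)
  pose m := maxn d (\max_(i <- t) i).+1.
  have tm : all (fun i => (i < m)%N) t.
    apply/allP => i it; rewrite leq_max ltnS; apply/orP; right.
    exact: leq_bigmax_seq.
  apply: (@cvg0_in_prob_cst _ _ _ P).
  have gm n p' : (p < p' <= q)%N -> forall t' : p'.-tuple nat, uniq t' ->
      ~~ all (fun i => (i < m)%N) t' -> g n p' t' = 0.
    move=> pp'q t' _ t'm; have /andP[pp' p'q] := pp'q.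
    have p'1 : (0 < p' <= q)%N by rewrite p'q (leq_ltn_trans _ pp').
    have t'd : ~~ all (fun i => (i < d)%N) t'.
      apply: contra t'm; apply: sub_all => i id.
      by rewrite (leq_trans id)// leq_maxl.
    have z (h : p'.-tuple nat -> R) : supported_in d h -> h t' = 0.
      by move=> hd; apply/eqP; apply: contraNT t'd; exact: hd.
    rewrite /g; case: eqP => [p'0|_]; first by rewrite p'0 in p'1.
    by rewrite (z _ (fn_supp n p' p'1)) (z _ (IHp p' pp'q)) subrr.
  move=> e e0.
  have subH := @subpoly_cvg0_in_prob _ _ _ X q P mX indX iX EX nX
    (fun n => n + d)%N g (mem t) m gdiag HP e e0.
  apply: vanishing_subset subH => [n|n|].
  - apply: measurable_normr_gt; exact: measurable_subpoly.
  - apply: measurable_normr_gt; exact: measurable_cst.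
  - exists m => // n /= mn x /=.
    have mN : (m <= n + d)%N by rewrite (leq_trans mn)// leq_addr.
    have [K K0 ->] := @subpoly_trace_eq _ _ _ X q (n + d)%N p t m (g n) x pq ut tm mN
      (gdiag n) (gsym n p pq) (gm n).
    (* [K] may vary with [n]; [K >= 1] suffices for [|g n p t| <= |g n p t *+ K|]. *)
    by move=> eg; rewrite normrMn (lt_le_trans eg)// -[leLHS]mulr1n ler_wpMn2l.
have fsupp p (pq : (1 <= p <= q)%N) : supported_in d (f p).
  by apply: f_zero => // t; apply: g0; case/andP: pq.
have finE Y : P.-integrable setT (EFin \o Y) -> 'E_P[Y]%E = (fine 'E_P[Y]%E)%:E.
  by move=> iY; rewrite fineK// unlock; exact: integrable_fin_num.
split.
  rewrite (finE _ iF) (_ : (fun n => _) = fun n => (fine 'E_P[Fn n]%E)%:E).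
    apply: cvg_EFin; first by apply: nearW.
    by apply/subr_cvg0; exact: (g0 0%N (leq0n q) [tuple]).
  by apply/funext => n; exact: finE.
(* All kernels live below [d], so these are finite sums and converge termwise at every [x]. *)
move=> p pq; apply: aeW => x.
rewrite (Q_supported _ _ d0 (fsupp p pq)).
rewrite (_ : (fun n => _) = fun n => Qtrunc X d (fn n p) x); last first.
  by apply/funext => n; exact: Q_supported (fn_supp n p pq).
apply: cvg_big => [|t _]; first exact: add_continuous.
apply: cvgM; last exact: cvg_cst.
set u := map_tuple _ t; have [uu|nu] := boolP (uniq u).
  have /andP[p0 pq'] := pq; apply/subr_cvg0.
  have := g0 p pq' u uu; rewrite (_ : (fun n => _) = fun n => fn n p u - f p u)//.
  by apply/funext => n; rewrite /g gtn_eqF.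
have [_ -> //_] := f_ell p pq.
rewrite (_ : (fun n => _) = cst 0); first exact: cvg_cst.
by apply/funext => n; have [_ -> //_] := fn_ell n p pq.
Qed.
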